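(* Let $G$ be a connected graph of order $n\geq 3$ such that its complement $\overline{G}$ is connected. Let $\Delta,\delta_1,p$ and $\overline{\Delta},\overline{\delta_1},\overline{p}$ denote the maximum degree, the minimum non-pendent vertex degree and the number of pendent vertices in $G$ and $\overline{G}$ respectively. Put $\alpha=\min\{\delta_1,\overline{\delta_1}\}$ and $\beta=\max\{\Delta,\overline{\Delta}\}$. Then \[(p+\overline{p})\left(\frac{n-2}{n-3}\right)^3\left(1-\left(\frac{n-2}{2}\right)^3\right)+\binom{n}{2}\left(\frac{\alpha^2}{2\alpha-2}\right)^3\;\leq\; AZI(G)+AZI(\overline{G})\;\leq\;\binom{n}{2}\left(\frac{\beta^2}{2\beta-2}\right)^3.\] Moreover, equality holds in the left inequality if and only if $G\cong P_4$ or $G$ is isomorphic to an $r$-regular graph with $2r+1$ vertices (for some $r$), and equality holds in the right inequality if and only if the same condition holds.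
   Context: All graphs are simple, finite and undirected; $d_u$ denotes the degree of the vertex $u$, and $E(G)$ the edge set of $G$. The augmented Zagreb index of a graph $G$ is \[AZI(G)=\sum_{uv\in E(G)}\left(\frac{d_ud_v}{d_u+d_v-2}\right)^3.\] The complement $\overline{G}$ has the same vertex set as $G$, with two distinct vertices adjacent in $\overline{G}$ exactly when they are not adjacent in $G$. A vertex is pendent if its degree is $1$; the minimum non-pendent vertex degree is the minimum degree among the vertices that are not pendent. A graph is $r$-regular if every vertex has degree $r$. $P_4$ is the path on $4$ vertices. *)

(* Defs.v *)
From HB Require Import structures.
From mathcomp Require Import all_boot all_order all_algebra.

Set Implicit Arguments.
Unset Strict Implicit.
Unset Printing Implicit Defensive.

Import GRing.Theory Num.Theory.

Record sgraph := SGraph {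
  vertex :> finType;
  adj : rel vertex;
  adj_sym : symmetric adj;
  adj_irr : irreflexive adj }.

Lemma compl_sym (G : sgraph) :
  symmetric [rel u v : G | (u != v) && ~~ adj u v].
Proof. by move=> u v /=; rewrite eq_sym adj_sym. Qed.

Lemma compl_irr (G : sgraph) :
  irreflexive [rel u v : G | (u != v) && ~~ adj u v].
Proof. by move=> u /=; rewrite eqxx. Qed.

Definition compl (G : sgraph) : sgraph := SGraph (@compl_sym G) (@compl_irr G).

Lemma path4_sym :
  symmetric [rel i j : 'I_4 | (i.+1 == j :> nat) || (j.+1 == i :> nat)].
Proof. by move=> i j /=; rewrite orbC. Qed.

Lemma path4_irr :
  irreflexive [rel i j : 'I_4 | (i.+1 == j :> nat) || (j.+1 == i :> nat)].
Proof. by move=> i /=; rewrite orbb gtn_eqF. Qed.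

Definition path4 : sgraph := SGraph path4_sym path4_irr.

(* This holds for the graph without vertices; a lower bound on the order has
   to be required separately. *)
Definition gconnected (G : sgraph) : Prop :=
  forall u v : G, connect (@adj G) u v.

Definition isomorphic (G H : sgraph) : Prop :=
  exists2 f : G -> H, bijective f & forall u v, adj (f u) (f v) = adj u v.

Definition deg (G : sgraph) (u : G) : nat := #|[set v | adj u v]|.

Definition regular (r : nat) (G : sgraph) : Prop := forall u : G, deg u = r.

Definition pendent (G : sgraph) (u : G) : bool := deg u == 1.

Definition num_pendent (G : sgraph) : nat := #|[set u : G | pendent u]|.

Definition max_deg (G : sgraph) : nat := \max_(u : G) deg u.

(* The neutral element #|G| exceeds every degree, so this is the minimum as
   soon as some vertex is not pendent, e.g. when G is connected with at least
   three vertices. *)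
Definition min_nonpendent_deg (G : sgraph) : nat :=
  \big[minn/#|G|]_(u : G | ~~ pendent u) deg u.

Definition edges (G : sgraph) : {set {set G}} :=
  [set [set p.1; p.2] | p in [set p : G * G | adj p.1 p.2]].

Local Open Scope ring_scope.

(* For an edge e = [set u; v] with u != v, the product and the sum over e are
   d_u * d_v and d_u + d_v. *)
Definition AZI (R : realFieldType) (G : sgraph) : R :=
  \sum_(e in edges G)
    ((\prod_(u in e) (deg u)%:R) / ((\sum_(u in e) (deg u)%:R) - 2)) ^+ 3.

(* Main.v *)
Require Import Defs.
From HB Require Import structures.
From mathcomp Require Import all_boot all_order all_algebra.
From mathcomp Require Import zify ring.

Set Implicit Arguments.
Unset Strict Implicit.
Unset Printing Implicit Defensive.

Import Order.TTheory GRing.Theory Num.Theory.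
Local Open Scope ring_scope.

(** Every pair of distinct vertices is an edge of exactly one of the graph [G]
    and its complement, so the sum of the two indices has ['C(n, 2)] terms, one
    for each pair: the weight [(x y / (x + y - 2)) ^ 3], where [x] and [y] are
    the degrees of the ends in whichever graph contains the edge.

    For [x, y >= 2] the weight is nondecreasing in [x] and in [y], so it lies
    between its values at [(alpha, alpha)] and [(beta, beta)]. A pendent edge
    has weight [(y / (y - 1)) ^ 3], which is at most 8, hence is no obstacle to
    the upper bound. It decreases in [y], and [y <= n - 2] because the
    complement is connected, so the [p + pbar] pendent edges have weight at
    least that of [(1, n - 2)]. The correction in the lower bound is what is
    lost when these edges are first charged the weight of [(n - 2, n - 2)],
    which is at least that of [(alpha, alpha)]
    ([edge_weight_lower_corrected], [edge_weight_upper]).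

    Each comparison of weights is proved together with its case of equality, as
    a conditionally strict inequality [_ <= _ ?= iff _]; these add up over
    all edges, and what remains is to determine the graphs all of whose edges
    are tight, in [G] and in the complement.

    - Upper bound. If [beta > 2], tightness makes all the degrees equal to
      [beta] in both graphs, so that [n = 2 beta + 1]. If [beta = 2], every
      edge is tight; degrees at most 2 in both graphs leave [n <= 5], and for
      [n = 5] both graphs are 2-regular.
    - Lower bound, [alpha = n - 2]. Each vertex is pendent in one of the two
      graphs. If [a] are pendent in [G] and [b] in the complement, counting the
      pairs between the two classes gives [a b = a + b], so [a = b = 2] and
      [n = 4] ([biconnected_extreme_degrees]).
    - Lower bound, [alpha < n - 2]. There is no pendent vertex. If [alpha > 2],
      all the degrees are equal to [alpha]. The delicate case is [alpha = 2],
      as the weight of [(2, y)] is 8 for every [y]: tightness then only says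
      that each edge has an end of degree 2 in the graph it belongs to. A clique
      argument leaves only [n = 5] ([biconnected_all_edges_deg2]).

    Finally [P_4] is the only graph with four vertices that is connected and
    has a connected complement ([biconnected_order4_path4]), which turns [n = 4]
    into the first extremal case. *)

(** * The weight of an edge *)

Definition edge_weight (R : realFieldType) (x y : nat) : R :=
  (x%:R * y%:R / (x%:R + y%:R - 2)) ^+ 3.

Lemma edge_weightC (R : realFieldType) x y :
  edge_weight R x y = edge_weight R y x.
Proof. by rewrite /edge_weight [x%:R * _]mulrC [x%:R + _]addrC. Qed.

Lemma edge_weight_diag (R : realFieldType) (x : nat) :
  edge_weight R x x = (x%:R ^+ 2 / (2 * x%:R - 2)) ^+ 3.
Proof. by rewrite /edge_weight expr2 [2 * _]mulr_natl mulr2n. Qed.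

Lemma leif_addn_eq0 (m n k : nat) (C : bool) :
  n = (m + k)%N -> (k == 0%N) = C -> (m <= n ?= iff C)%N.
Proof.
by move=> -> <-; split; [exact: leq_addr | rewrite -{1}[m]addn0 eqn_add2l eq_sym].
Qed.

(** Clearing denominators turns a comparison of weights into one of natural
    numbers; those are settled below by writing the difference of the two
    sides as a polynomial with natural coefficients. *)
Lemma leif_edge_weight (R : realFieldType) (x y x' y' : nat) (C : bool) :
    (2 < x + y)%N -> (2 < x' + y')%N ->
    (x * y * (x' + y' - 2) <= x' * y' * (x + y - 2) ?= iff C)%N ->
  edge_weight R x y <= edge_weight R x' y' ?= iff C.
Proof.
move=> xy xy' h.
have frac a b : (2 < a + b)%N ->
    a%:R * b%:R / (a%:R + b%:R - 2) = (a * b)%:R / (a + b - 2)%:R :> R.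
  by move=> ab; rewrite natrB ?natrM ?natrD // ltnW.
have pos a b : (2 < a + b)%N -> 0 < (a + b - 2)%:R :> R.
  by rewrite ltr0n subn_gt0.
have nneg a b : ((a * b)%:R / (a + b - 2)%:R : R) \in Num.nneg.
  by rewrite nnegrE divr_ge0 ?ler0n.
rewrite /edge_weight !frac //.
rewrite (mono_in_leif (ler_pXn2r (isT : (0 < 3)%N))) ?nneg //.
rewrite -(leif_nat_r R) !natrM in h.
have [le_h eq_h] := h; split.
  by rewrite ler_pdivrMr ?pos // mulrAC ler_pdivlMr ?pos // !natrM.
by rewrite eqr_div -?eq_h ?natrM // lt0r_neq0 ?pos.
Qed.

(** With [x = a + s] and [y = a + t] the difference of the two sides is, once
    the denominators are cleared,
    [(s + t) a (a - 2) + 2 s t (a - 1)]. It vanishes for [s = t = 0], but for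
    [a = 2] also as soon as one of [s] and [t] does. *)
Lemma edge_weight_lower (R : realFieldType) (a x y : nat) :
    (1 < a)%N -> (a <= x)%N -> (a <= y)%N ->
  edge_weight R a a <= edge_weight R x y
    ?= iff ((x == a) && (y == a) || (a == 2%N) && ((x == 2%N) || (y == 2%N))).
Proof.
case: a => [|[|a]] // _ /subnKC <- /subnKC <-.
move: (x - _)%N (y - _)%N => s t {x y}.
apply: leif_edge_weight; [lia | lia |].
apply: (@leif_addn_eq0 _ _ ((s + t) * (a.+2 * a) + s * t * (2 * a + 2))%N).
  have -> : (a.+2 + s + (a.+2 + t) - 2 = 2 * a + 2 + s + t)%N by lia.
  have -> : (a.+2 + a.+2 - 2 = 2 * a + 2)%N by lia.
  ring.
by apply/idP/idP; nia.
Qed.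

(** The case [b = 2] is special: it leaves only the degrees [(1, 2)] and
    [(2, 2)], which have the same weight 8. *)
Definition upper_tight (b x y : nat) : bool :=
  (b == 2%N) || (x == b) && (y == b).

Lemma edge_weight_upper (R : realFieldType) (b x y : nat) :
    (0 < x)%N -> (0 < y)%N -> (2 < x + y)%N -> (x <= b)%N -> (y <= b)%N ->
  edge_weight R x y <= edge_weight R b b
    ?= iff upper_tight b x y.
Proof.
wlog: x y / (x <= y)%N => [wl|].
  have [/wl//|/ltnW yx ? ? xy xb yb] := leqP x y.
  by rewrite edge_weightC /upper_tight [_ && _]andbC;
    apply: wl; rewrite // addnC.
rewrite /upper_tight.
case: x y b => [|[|i]] [|[|j]] [|[|k]] //= _ _ _ _ ik jk.
  have [t ->] : exists t, k = (j + t)%N by exists (k - j)%N; lia.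
  apply: leif_edge_weight; [lia | lia |]; set k' := (j + t)%N.
  apply: (@leif_addn_eq0 _ _ (k' * k' * j + 2 * k' * j + 2 * j + k' * k')%N).
    have -> : (1 + j.+2 - 2 = j + 1)%N by lia.
    have -> : (k'.+2 + k'.+2 - 2 = 2 * k' + 2)%N by lia.
    ring.
  by apply/idP/idP; rewrite /k'; nia.
have [s def_k] : exists s, k = (i + s)%N by exists (k - i)%N; lia.
have [t def_k'] : exists t, k = (j + t)%N by exists (k - j)%N; lia.
apply: leif_edge_weight; [lia | lia |].
apply: (@leif_addn_eq0 _ _ ((s * j + t * i) * (k + 1) + (s + t) * k)%N).
  have -> : (i.+2 + j.+2 - 2 = i + j + 2)%N by lia.
  have -> : (k.+2 + k.+2 - 2 = 2 * k + 2)%N by lia.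
  (* Here [k = i + s = j + t] gives [(s + t) k = 2 s t + s j + t i]. *)
  have def_t : t = (i + s - j)%N by lia.
  nia.
by apply/idP/idP; nia.
Qed.

(** [y / (y - 1)] is decreasing in [y]. *)
Lemma edge_weight_pendent (R : realFieldType) (m y : nat) :
    (1 < y)%N -> (y <= m)%N ->
  edge_weight R 1 m <= edge_weight R 1 y ?= iff (y == m).
Proof.
case: y => [|[|y]] // _ /subnKC <-; move: (m - _)%N => t.
apply: leif_edge_weight; [lia | lia |].
apply: (@leif_addn_eq0 _ _ t); last by apply/idP/idP; lia.
have -> : (1 + (y.+2 + t) - 2 = y + t + 1)%N by lia.
have -> : (1 + y.+2 - 2 = y + 1)%N by lia.
ring.
Qed.

(** For a pendent edge the bound goes through the weights of [(m, m)] and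
    [(1, m)], so equality needs [a = m] and the other end of degree [m]. *)
Definition lower_tight (a m x y : nat) : bool :=
  if (x == 1%N) || (y == 1%N) then (a == m) && (x + y == m.+1)%N
  else (x == a) && (y == a) || (a == 2%N) && ((x == 2%N) || (y == 2%N)).

(** The lower bound for every edge, pendent or not. On a pendent edge it reads
    [w(a, a) - w(m, m) + w(1, m) <= w(1, y)], the sum of
    [w(a, a) <= w(m, m)] and [w(1, m) <= w(1, y)]. *)
Lemma edge_weight_lower_corrected (R : realFieldType) (a m x y : nat) :
    (1 < a)%N -> (a <= m)%N -> (0 < x <= m)%N -> (0 < y <= m)%N ->
    (2 < x + y)%N -> (x != 1%N -> a <= x)%N -> (y != 1%N -> a <= y)%N ->
  edge_weight R a a
    + (edge_weight R 1 m - edge_weight R m m) * ((x == 1%N) + (y == 1%N))%:R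
  <= edge_weight R x y ?= iff lower_tight a m x y.
Proof.
move=> a1 am.
wlog: x y / (x <= y)%N => [wl|].
  have [/wl//|/ltnW yx hx hy xy xa ya] := leqP x y.
  rewrite (edge_weightC R x y) [(_ + _)%N]addnC.
  have -> : lower_tight a m x y = lower_tight a m y x.
    by rewrite /lower_tight addnC orbC [(x == a) && _]andbC [(x == 2%N) || _]orbC.
  by apply: wl; rewrite // addnC.
move=> xy /andP[x0 xm] /andP[y0 ym] xy2 ax ay; rewrite /lower_tight.
have y1 : (y == 1%N) = false by lia.
rewrite y1 orbF addn0; have [x1|/ax {}ax] := eqVneq x 1%N; last first.
  rewrite mulr0 addr0; apply: edge_weight_lower => //.
  by apply: leq_trans xy.
rewrite x1 mulr1 add1n eqSS.
have am_leif : edge_weight R a a <= edge_weight R m m ?= iff (a == m).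
  have := edge_weight_lower R a1 am am.
  by congr (_ <= _ ?= iff _); lia.
have y2 : (1 < y)%N by lia.
have := leifD am_leif (edge_weight_pendent R y2 ym).
by rewrite andbC addrA [X in _ <= X ?= iff _]addrC -leifBLR andbC.
Qed.

Lemma adj_neq (G : sgraph) (u v : G) : adj u v -> u != v.
Proof. by apply: contraTN => /eqP->; rewrite adj_irr. Qed.

(** * Summing over the edges of a graph and of its complement *)

(** Summing over ordered pairs of adjacent vertices makes the two ends of an
    edge available; each edge is then counted twice. *)
Lemma double_AZI (R : realFieldType) (G : sgraph) :
  AZI R G *+ 2 =
    \sum_(u : G) \sum_(v | adj u v) edge_weight R (deg u) (deg v).
Proof.
pose h (p : G * G) := [set p.1; p.2].
pose F (e : {set G}) : R :=
  (\prod_(u in e) (deg u)%:R / (\sum_(u in e) (deg u)%:R - 2)) ^+ 3.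
have F_pair u v : adj u v -> F [set u; v] = edge_weight R (deg u) (deg v).
  move=> /adj_neq uv.
  by rewrite /F !big_setU1 ?inE //= !big_set1.
rewrite pair_big_dep /=.
transitivity (\sum_(p in [set p : G * G | adj p.1 p.2]) F (h p)).
  rewrite (partition_big_imset h) /= /AZI -sumrMnl; apply: eq_bigr => e.
  case/imsetP=> -[u v]; rewrite inE /= => uv ->.
  rewrite (eq_bigl (fun q => q \in [set (u, v); (v, u)])) => [|[x y]].
    transitivity (\sum_(q in [set (u, v); (v, u)]) F [set u; v]).
      by rewrite sumr_const cards2 xpair_eqE negb_and adj_neq.
    apply: eq_bigr; rewrite /h; case=> x y.
    by rewrite !inE => /orP[] /eqP[-> ->] /=; rewrite ?(setUC [set v]).
  rewrite !inE /= !xpair_eqE /h /=; apply/andP/orP.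
    case=> /adj_neq xy /eqP exy.
    have : x \in [set u; v] by rewrite -exy set21.
    have : y \in [set u; v] by rewrite -exy set22.
    rewrite !inE => /orP[]/eqP yE /orP[]/eqP xE; subst x y.
    - by rewrite eqxx in xy.
    - by right; rewrite !eqxx.
    - by left; rewrite !eqxx.
    - by rewrite eqxx in xy.
  case=> /andP[/eqP-> /eqP->]; first by rewrite uv eqxx.
  by rewrite adj_sym uv setUC eqxx.
rewrite big_mkcond [RHS]big_mkcond; apply: eq_bigr => -[u v] _.
by rewrite inE /h /=; case: ifP => // /F_pair.
Qed.

(** A pendent vertex has one neighbour, so it contributes 1 from either side. *)
Lemma sum_adj_pendent (G : sgraph) :
  (\sum_(u : G) \sum_(v | adj u v) (pendent u + pendent v)
    = 2 * num_pendent G)%N.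
Proof.
have sumL : (\sum_(u : G) \sum_(v | adj u v) pendent u = num_pendent G)%N.
  rewrite /num_pendent -sum1_card [RHS]big_mkcond; apply: eq_bigr => u _.
  rewrite sum_nat_cond_const inE /pendent /deg cardsE.
  by case: eqP => [->|]; rewrite ?muln0.
under eq_bigr do rewrite big_split.
rewrite big_split /= sumL (exchange_big_dep predT) //= mul2n -addnn.
congr (_ + _)%N; rewrite -sumL; apply: eq_bigr => v _.
by apply: eq_bigl => u; rewrite adj_sym.
Qed.

Lemma deg_compl (G : sgraph) (u : G) :
  (deg u + @deg (compl G) u).+1 = #|G|.
Proof.
rewrite -(cardsC [set v | adj u v]) /deg -addnS; congr (_ + _)%N.
rewrite (cardsD1 u (~: _)) !inE adj_irr /=; congr _.+1; apply: eq_card => v.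
by rewrite !inE /= eq_sym.
Qed.

(** In the two graphs together each vertex has [#|G| - 1] neighbours. *)
Lemma sum_deg_compl (G : sgraph) :
  (\sum_(u : G) deg u + \sum_(u : compl G) deg u = 2 * 'C(#|G|, 2))%N.
Proof.
rewrite -mul_bin_diag bin1 -big_split /= -sum_nat_const.
by apply: eq_bigr => u _; rewrite -(deg_compl u).
Qed.

Lemma AZI_lower (R : realFieldType) (G : sgraph) (a m : nat) :
    (1 < a)%N -> (a <= m)%N -> (forall u : G, (0 < deg u <= m)%N) ->
    (forall u : G, ~~ pendent u -> (a <= deg u)%N) ->
    (forall u v : G, adj u v -> (2 < deg u + deg v)%N) ->
  edge_weight R a a *+ (\sum_(u : G) deg u)
    + (edge_weight R 1 m - edge_weight R m m) *+ (2 * num_pendent G)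
  <= AZI R G *+ 2
    ?= iff [forall u : G, forall (v | adj u v),
      lower_tight a m (deg u) (deg v)].
Proof.
move=> a1 am dm da dd.
set K := edge_weight R 1 m - _.
have -> : edge_weight R a a *+ (\sum_(u : G) deg u) + K *+ (2 * num_pendent G)
    = \sum_(u : G) \sum_(v | adj u v)
        (edge_weight R a a + K * (pendent u + pendent v)%:R).
  rewrite -sum_adj_pendent -!sumrMnr -big_split; apply: eq_bigr => u _ /=.
  rewrite [RHS]big_split sumr_const /deg cardsE /=; congr (_ + _).
  by rewrite -sumrMnr; apply: eq_bigr => v _; rewrite mulr_natr.
rewrite double_AZI; apply: leif_sum => u _; apply: leif_sum => v uv.
by apply: edge_weight_lower_corrected; rewrite ?dm ?dd //; exact: da.
Qed.

Lemma AZI_upper (R : realFieldType) (G : sgraph) (b : nat) :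
    (forall u : G, (0 < deg u <= b)%N) ->
    (forall u v : G, adj u v -> (2 < deg u + deg v)%N) ->
  AZI R G *+ 2 <= edge_weight R b b *+ (\sum_(u : G) deg u)
    ?= iff [forall u : G, forall (v | adj u v),
             upper_tight b (deg u) (deg v)].
Proof.
move=> db dd.
rewrite double_AZI -sumrMnr; apply: leif_sum => u _.
have -> : edge_weight R b b *+ deg u = \sum_(v | adj u v) edge_weight R b b.
  by rewrite sumr_const /deg cardsE.
apply: leif_sum => v uv.
have /andP[u0 ub] := db u; have /andP[v0 vb] := db v.
by apply: edge_weight_upper; rewrite ?dd.
Qed.

(** * Connected graphs, cliques and regularity *)

Lemma crossing_edge (G : sgraph) (S : {set G}) (x y : G) :
    gconnected G -> x \in S -> y \notin S ->
  exists u v, [/\ u \in S, v \notin S & adj u v].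
Proof.
move=> conn xS yS.
have [/existsP[u /existsP[v /and3P[]]]|/existsPn noedge] :=
  boolP [exists u, exists v, [&& u \in S, v \notin S & @adj G u v]].
  by exists u, v.
suff cl : closed (@adj G) [in S].
  by have := closed_connect cl (conn x y); rewrite /= xS (negbTE yS).
move=> u v uv /=.
have /existsPn/(_ v) := noedge u; have /existsPn/(_ u) := noedge v.
by rewrite uv adj_sym uv !andbT; case: (u \in S); case: (v \in S).
Qed.

Lemma exists_notin (T : finType) (S : {set T}) :
  (#|S| < #|T|)%N -> exists x, x \notin S.
Proof.
move=> S_lt; suff /set0Pn[x] : ~: S != set0 by rewrite inE; exists x.
by rewrite -card_gt0 -(ltn_add2l #|S|) cardsC addn0.
Qed.

Lemma deg_gt0P (G : sgraph) (u : G) :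
  reflect (exists v, adj u v) (0 < deg u)%N.
Proof.
rewrite card_gt0; apply: (iffP (set0Pn _)) => -[v];
  by rewrite ?inE; exists v; rewrite ?inE.
Qed.

Lemma pendent_adj_inj (G : sgraph) (u v w : G) :
  pendent u -> adj u v -> adj u w -> v = w.
Proof.
move=> /cards1P[x ux] uv uw.
have : v \in [set z | adj u z] by rewrite inE.
have : w \in [set z | adj u z] by rewrite inE.
by rewrite ux !inE => /eqP-> /eqP->.
Qed.

Lemma deg_gt0 (G : sgraph) (u : G) :
  gconnected G -> (1 < #|G|)%N -> (0 < deg u)%N.
Proof.
move=> conn n1; have [|y yu] := @exists_notin G [set u]; first by rewrite cards1.
have [x [v [/set1P-> _ uv]]] := crossing_edge conn (set11 u) yu.
by apply/deg_gt0P; exists v.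
Qed.

(** Two adjacent pendent vertices would form a component by themselves. *)
Lemma deg_sum_gt2 (G : sgraph) (u v : G) :
  gconnected G -> (2 < #|G|)%N -> adj u v -> (2 < deg u + deg v)%N.
Proof.
move=> conn n2 uv.
have u0 : (0 < deg u)%N by apply: deg_gt0 => //; apply: ltnW.
have v0 : (0 < deg v)%N by apply: deg_gt0 => //; apply: ltnW.
rewrite ltnNge; apply/negP => uv2.
have pu : pendent u by rewrite /pendent; lia.
have pv : pendent v by rewrite /pendent; lia.
have [|y y_uv] := @exists_notin G [set u; v].
  by rewrite cards2 (leq_ltn_trans _ n2) // ltnS leq_b1.
have [x [w [+ w_uv xw]]] := crossing_edge conn (set21 u v) y_uv.
move: w_uv; rewrite !inE => /norP[wu wv] /orP[]/eqP xE; subst x.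
  by rewrite (pendent_adj_inj pu xw uv) eqxx in wv.
by rewrite (pendent_adj_inj pv xw (_ : adj v u)) ?eqxx // adj_sym in wu.
Qed.

Lemma clique_card_le (H : sgraph) (K : {set H}) (x : H) :
    {in K &, forall u v, u != v -> adj u v} -> x \in K ->
  (#|K| <= (deg x).+1)%N.
Proof.
move=> cl xK; rewrite (cardsD1 x) xK ltnS; apply: subset_leq_card.
by apply/subsetP=> v; rewrite !inE eq_sym => /andP[xv vK]; apply: cl.
Qed.

(** The neighbours of [x] in the clique already exhaust its degree. *)
Lemma clique_closed (H : sgraph) (K : {set H}) (x v : H) :
    {in K &, forall u v, u != v -> adj u v} -> x \in K ->
    (deg x < #|K|)%N -> adj x v -> v \in K.
Proof.
move=> cl xK; rewrite (cardsD1 x) xK ltnS => dK xv.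
have sub : K :\ x \subset [set v | adj x v].
  by apply/subsetP=> y; rewrite !inE eq_sym => /andP[xy yK]; apply: cl.
have : v \in [set v | adj x v] by rewrite inE.
have /eqP <- : K :\ x == [set v | adj x v] by rewrite eqEcard sub.
by rewrite inE => /andP[].
Qed.

Lemma adj_const_regular (H : sgraph) (r : nat) :
    (forall u : H, (0 < deg u)%N) ->
    (forall u v : H, adj u v -> deg u = r) -> regular r H.
Proof. by move=> d0 d u; have /deg_gt0P[v /d] := d0 u. Qed.

(** Since the degrees of a vertex in the two graphs add up to [#|G| - 1], this
    says that [G] is [r]-regular with [2 r + 1] vertices. *)
Definition both_regular (G : sgraph) : Prop :=
  exists r, regular r G /\ regular r (compl G).

(** * Connected graphs with a connected complement *)

Section Biconnected.

Variables (G : sgraph) (n : nat).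
Hypothesis conn : gconnected G.
Hypothesis conn_compl : gconnected (compl G).
Hypothesis order_eq : #|G| = n.
Hypothesis n_gt2 : (2 < n)%N.

Lemma deg_add_compl (u : G) : (deg u + @deg (compl G) u).+1 = n.
Proof. by rewrite deg_compl. Qed.

Lemma edge_deg_sum (u v : G) : adj u v -> (2 < deg u + deg v)%N.
Proof. by apply: deg_sum_gt2; rewrite ?order_eq. Qed.

Lemma compl_edge_deg_sum (u v : compl G) : adj u v -> (2 < deg u + deg v)%N.
Proof. by apply: deg_sum_gt2; rewrite ?order_eq. Qed.

Lemma biconnected_deg (u : G) : (0 < deg u <= n - 2)%N.
Proof.
have n1 : (1 < #|G|)%N by rewrite order_eq ltnW.
have := @deg_gt0 (compl G) u conn_compl n1; have := @deg_gt0 G u conn n1.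
by have := deg_add_compl u; lia.
Qed.

Lemma biconnected_deg_compl (u : compl G) : (0 < deg u <= n - 2)%N.
Proof. by have := biconnected_deg u; have := deg_add_compl u; lia. Qed.

Lemma exists_vertex : exists u : G, u \notin set0.
Proof. by apply: exists_notin; rewrite cards0 order_eq; lia. Qed.

(** For three vertices all the degrees would be 1, against [edge_deg_sum]. *)
Lemma biconnected_order_ge4 : (3 < n)%N.
Proof.
have [u _] := exists_vertex.
have /andP[/deg_gt0P[v uv] du] := biconnected_deg u.
by have := biconnected_deg v; have := edge_deg_sum uv; lia.
Qed.

(** Let [A] and [B] be the two classes. As pendent vertices of the same graph
    are not adjacent, each vertex of [A] has its only neighbour in [B], and
    each vertex of [B] has its only neighbour in the complement in [A]. The
    pairs in [A * B] are split between the two graphs, so there are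
    [#|A| + #|B|] of them. Hence [(#|A| - 1) (#|B| - 1) = 1]. *)
Lemma biconnected_extreme_degrees :
    (forall u : G, pendent u || @pendent (compl G) u) ->
  (#|[set u : G | pendent u]| = 2 /\ #|[set u : G | @pendent (compl G) u]| = 2)%N.
Proof.
move=> ext; have n3 := biconnected_order_ge4.
set A := [set u | _]; set B := [set u : G | _].
have BE u : (u \in B) = (u \notin A).
  rewrite !inE; have := ext u; have := deg_add_compl u.
  by rewrite /pendent; case: eqP; case: eqP => //=; lia.
have degA u : u \in A -> (\sum_(v in B) @adj G u v = 1)%N.
  rewrite inE => pu; rewrite -(eqP pu) /deg -sum1_card [RHS]big_mkcond.
  rewrite [LHS]big_mkcond; apply: eq_bigr => v _; rewrite BE !inE.
  case: ifPn => [_|/negPn pv]; first by case: adj.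
  case uv: (adj u v) => //; have := edge_deg_sum uv.
  by rewrite (eqP pu) (eqP pv).
have degB v : v \in B -> (\sum_(u in A) @adj (compl G) v u = 1)%N.
  rewrite inE => pv; rewrite -(eqP pv) /deg -sum1_card [RHS]big_mkcond.
  rewrite [LHS]big_mkcond; apply: eq_bigr => u _.
  have [uA|uA] := boolP (u \in A); first by rewrite inE; case: adj.
  rewrite inE; case vu: (@adj (compl G) v u) => //.
  have := compl_edge_deg_sum vu.
  by rewrite -BE inE in uA; rewrite (eqP pv) (eqP uA).
have AB : (#|A| + #|B| = #|A| * #|B|)%N.
  have -> : (#|A| * #|B| = \sum_(u in A) \sum_(v in B) 1)%N.
    by rewrite sum_nat_const sum1_card.
  rewrite -[in LHS]sum1_card -[X in (_ + X)%N]sum1_card.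
  rewrite -(eq_bigr _ degA) -[X in (_ + X)%N](eq_bigr _ degB).
  rewrite [X in (_ + X)%N]exchange_big -big_split /=.
  apply: eq_bigr => u uA; rewrite -big_split.
  apply: eq_bigr => v; rewrite BE /= adj_sym; case: (eqVneq v u) => [->|_].
    by rewrite uA.
  by case: adj.
have := cardsC A; rewrite order_eq.
have -> : ~: A = B by apply/setP=> u; rewrite inE BE.
by move: #|A| #|B| AB => [|[|[|a]]] [|[|[|b]]]; nia.
Qed.

(** With four vertices the degrees are 1 and 2, so there are two pendent
    vertices [u], [v] and two vertices [w], [x] of degree 2. If [w] is the
    neighbour of [u], the path is [u w x v]. *)
Lemma biconnected_order4_path4 : n = 4%N -> isomorphic G path4.
Proof.
move=> n4.
have ext (u : G) : pendent u || @pendent (compl G) u.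
  have := biconnected_deg u; have := deg_add_compl u; rewrite /pendent.
  lia.
have [] := biconnected_extreme_degrees ext.
move=> /eqP/cards2P[u [v [uv def_A]]] /eqP/cards2P[w0 [x0 [wx0 def_B]]].
have pu : pendent u by have := set21 u v; rewrite -def_A inE.
have pv : pendent v by have := set22 u v; rewrite -def_A inE.
have pE (z : G) : pendent z = (z == u) || (z == v).
  by have /setP/(_ z) := def_A; rewrite !inE.
have nuv : ~~ adj u v.
  apply/negP => /edge_deg_sum.
  by rewrite (eqP pu) (eqP pv).
have [w [x [wx def_B' uw]]] : exists w x, [/\ w != x,
    [set u : G | @pendent (compl G) u] = [set w; x] & adj u w].
  have /andP[/deg_gt0P[w uw] _] := biconnected_deg u.
  have : w \in [set u : G | @pendent (compl G) u].
    have := ext w; rewrite inE pE; case: eqP uw => [->|_].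
      by rewrite adj_irr.
    by case: eqP => [->|//]; rewrite (negbTE nuv).
  rewrite def_B !inE => /orP[] /eqP wE; subst w.
    by exists w0, x0.
  by exists x0, w0; rewrite eq_sym setUC.
have p'E (z : G) : @pendent (compl G) z = (z == w) || (z == x).
  by have /setP/(_ z) := def_B'; rewrite !inE.
have cover (z : G) : [|| z == u, z == v, z == w | z == x].
  by have := ext z; rewrite pE p'E -orbA.
(* Two vertices pendent in the complement are not adjacent there. *)
have awx : adj w x.
  apply: contraT => nwx; have awx : @adj (compl G) w x by rewrite /= wx.
  have := compl_edge_deg_sum awx.
  have pw : @pendent (compl G) w by rewrite p'E eqxx.
  have px : @pendent (compl G) x by rewrite p'E eqxx orbT.
  by rewrite (eqP pw) (eqP px).
have disj (z : G) : pendent z -> ~~ @pendent (compl G) z.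
  by have := deg_add_compl z; rewrite /pendent; clear -n4; lia.
have [uw' ux'] : u != w /\ u != x.
  by apply/andP; rewrite -negb_or -p'E disj.
have [vw' vx'] : v != w /\ v != x.
  by apply/andP; rewrite -negb_or -p'E disj.
have nux : adj u x = false.
  by apply/negP => /(pendent_adj_inj pu uw) wE; rewrite wE eqxx in wx.
(* Otherwise [w], of degree 2, would have the three neighbours [u], [v], [x]. *)
have nvw : adj v w = false.
  apply/negP => vw; have pw : @pendent (compl G) w by rewrite p'E eqxx.
  have : deg w = 2%N.
    by have := deg_add_compl w; move: pw; rewrite /pendent; clear -n4; lia.
  rewrite /deg (cardsD1 u) (cardsD1 v) (cardsD1 x) !inE.
  rewrite [adj w u]adj_sym uw [adj w v]adj_sym vw awx.
  by rewrite [v == u]eq_sym (negbTE uv) ![x == _]eq_sym (negbTE vx') (negbTE ux').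
have avx : adj v x.
  have /andP[/deg_gt0P[y vy] _] := biconnected_deg v.
  case/or4P: (cover y) vy => /eqP->; rewrite ?adj_irr ?nvw //.
  by rewrite adj_sym (negbTE nuv).
have nvu : adj v u = false by rewrite adj_sym; apply/negbTE.
pose f (z : G) : path4 := inord
  (if z == u then 0 else if z == w then 1 else if z == x then 2 else 3).
have vuF : (v == u) = false by rewrite eq_sym; apply/negbTE.
have wuF : (w == u) = false by rewrite eq_sym; apply/negbTE.
have xuF : (x == u) = false by rewrite eq_sym; apply/negbTE.
have xwF : (x == w) = false by rewrite eq_sym; apply/negbTE.
have fE : (f u = inord 0) * (f w = inord 1) * (f x = inord 2)
  * (f v = inord 3).
  by rewrite /f !eqxx wuF xuF xwF vuF (negbTE vw') (negbTE vx').
have f_inj : injective f.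
  move=> y z; case/or4P: (cover y) => /eqP->; case/or4P: (cover z) => /eqP-> //;
    by rewrite !fE => /(congr1 val) /=; rewrite !inordK.
exists f; first by apply: inj_card_bij; rewrite // card_ord order_eq n4.
have adjE : (adj u w = true) * (adj w u = true) * (adj w x = true)
  * (adj x w = true) * (adj x v = true) * (adj v x = true)
  * (adj u v = false) * (adj v u = false) * (adj u x = false)
  * (adj x u = false) * (adj v w = false) * (adj w v = false).
  by have nuvF := negbTE nuv; do !split; rewrite // adj_sym.
by move=> y z; case/or4P: (cover y) => /eqP->; case/or4P: (cover z) => /eqP->;
  rewrite !fE ?adjE ?adj_irr // /= !inordK.
Qed.

(** Degrees at least 2 in both graphs leave degree 2 everywhere when there are
    at most five vertices. In general, the vertices whose degree in the
    complement is not 2 form a clique [S] of [G], and those whose degree in [G]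
    is not 2 form a clique [T] of the complement. A clique containing a vertex
    of degree 2 has at most three vertices, and [S] and [T] cover all the
    vertices. If there are at least six vertices, then [S] and [T] are disjoint
    with three vertices each, so [S] is a triangle of vertices of degree 2, and
    no edge can leave it. *)
Lemma biconnected_all_edges_deg2 :
    (forall u : G, ~~ pendent u) -> (forall u : compl G, ~~ pendent u) ->
    (forall u v : G, adj u v -> (deg u == 2%N) || (deg v == 2%N)) ->
    (forall u v : compl G, adj u v -> (deg u == 2%N) || (deg v == 2%N)) ->
  both_regular G.
Proof.
move=> np np' t t'; have n3 := biconnected_order_ge4.
have d2 (u : G) : (1 < deg u)%N.
  by have := np u; have := biconnected_deg u; rewrite /pendent; lia.
have d2' (u : G) : (1 < @deg (compl G) u)%N.
  by have := np' u; have := biconnected_deg_compl u; rewrite /pendent; lia.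
have [n5|n6] := leqP n 5.
  exists 2%N; split=> u; have := deg_add_compl u; have := d2 u; have := d2' u;
    lia.
pose S := [set u : G | @deg (compl G) u != 2%N].
pose T := [set u : G | deg u != 2%N].
have clS : {in S &, forall u v, u != v -> @adj G u v}.
  move=> u v; rewrite !inE => /negbTE uS /negbTE vS uv; apply: contraT => nuv.
  by have := t' u v; rewrite uS vS /= uv nuv; apply.
have clT : {in T &, forall u v, u != v -> @adj (compl G) u v}.
  move=> u v; rewrite !inE => /negbTE uS /negbTE vS uv /=; rewrite uv.
  by apply/negP => /t; rewrite uS vS.
have [a da] : exists a : G, deg a = 2%N.
  have [u _] := exists_vertex.
  have /andP[/deg_gt0P[v uv] _] := biconnected_deg u.
  by case/orP: (t _ _ uv) => /eqP du; [exists u | exists v].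
have [b db] : exists b : G, @deg (compl G) b = 2%N.
  have [u _] := exists_vertex.
  have /andP[/deg_gt0P[v uv] _] := biconnected_deg_compl u.
  by case/orP: (t' _ _ uv) => /eqP du; [exists u | exists v].
have aS : a \in S by rewrite inE; apply/eqP; have := deg_add_compl a; lia.
have bT : b \in T by rewrite inE; apply/eqP; have := deg_add_compl b; lia.
have S3 : (#|S| <= 3)%N by have := clique_card_le clS aS; rewrite da.
have T3 : (#|T| <= 3)%N.
  by have := @clique_card_le (compl G) _ _ clT bT; rewrite db.
have ST : S :|: T = setT.
  apply/setP=> u; rewrite !inE -negb_and; apply/negP => /andP[/eqP ? /eqP ?].
  by have := deg_add_compl u; lia.
have := cardsUI S T; rewrite ST cardsT order_eq => cST.
have ST0 : S :&: T = set0 by apply/eqP; rewrite -cards_eq0; lia.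
have [|y yS] := @exists_notin G S; first by rewrite order_eq; lia.
have [u [v [uS vS uv]]] := crossing_edge conn aS yS.
case/negP: vS; apply: (clique_closed clS uS _ uv).
suff -> : deg u = 2%N by lia.
by have := in_set0 u; rewrite -ST0 inE uS /= inE => /negbT/negPn/eqP.
Qed.

(** * Graphs all of whose edges are tight *)

Lemma lower_tight_structure (a : nat) :
    (1 < a)%N ->
    (forall u : G, ~~ pendent u -> (a <= deg u)%N) ->
    (forall u : compl G, ~~ pendent u -> (a <= deg u)%N) ->
    (forall u v : G, adj u v -> lower_tight a (n - 2) (deg u) (deg v)) ->
    (forall u v : compl G, adj u v -> lower_tight a (n - 2) (deg u) (deg v)) ->
  n = 4%N \/ both_regular G.
Proof.
move=> a1 da da' t t'; have n3 := biconnected_order_ge4.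
have [am|am] := eqVneq a (n - 2)%N.
  left; have [|A2 B2] := biconnected_extreme_degrees.
    move=> u; case: (boolP (pendent u)) => //= /da.
    have := deg_add_compl u; have := biconnected_deg_compl u.
    by rewrite /pendent; lia.
  have BE : [set u : G | @pendent (compl G) u] = ~: [set u : G | pendent u].
    apply/setP => u; rewrite !inE; apply/idP/idP.
      by have := deg_add_compl u; rewrite /pendent; lia.
    move/da; have := deg_add_compl u; have := biconnected_deg_compl u.
    by rewrite /pendent; lia.
  by rewrite -order_eq -(cardsC [set u : G | pendent u]) -BE A2 B2.
right.
have np (u : G) : ~~ pendent u.
  apply/negP => pu; have /andP[/deg_gt0P[v /t tv] _] := biconnected_deg u.
  by move: tv; rewrite /lower_tight (eqP pu) /= (negbTE am).
have np' (u : G) : ~~ @pendent (compl G) u.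
  apply/negP => pu; have /andP[/deg_gt0P[v /t' tv] _] := biconnected_deg_compl u.
  by move: tv; rewrite /lower_tight (eqP pu) /= (negbTE am).
have npE (u : G) : (deg u == 1%N) = false := negbTE (np u).
have npE' (u : G) : (@deg (compl G) u == 1%N) = false := negbTE (np' u).
have {}t (u v : G) : adj u v -> (deg u == a) && (deg v == a) ||
    (a == 2%N) && ((deg u == 2%N) || (deg v == 2%N)).
  by move/t; rewrite /lower_tight !npE.
have {}t' (u v : G) : @adj (compl G) u v ->
    (@deg (compl G) u == a) && (@deg (compl G) v == a) ||
    (a == 2%N) && ((@deg (compl G) u == 2%N) || (@deg (compl G) v == 2%N)).
  by move/t'; rewrite /lower_tight !npE'.
have [a2|a2] := eqVneq a 2%N.
  by apply: biconnected_all_edges_deg2 => // u v; [move/t | move/t'];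
    rewrite a2 /=; case: eqP => //= _; rewrite orbF.
exists a; split; apply: adj_const_regular => u.
- by have /andP[] := biconnected_deg u.
- by move=> v /t; rewrite (negbTE a2) orbF => /andP[/eqP].
- by have /andP[] := biconnected_deg_compl u.
- by move=> v /t'; rewrite (negbTE a2) orbF => /andP[/eqP].
Qed.

Lemma upper_tight_structure (b : nat) :
    (forall u : G, (deg u <= b)%N) -> (forall u : compl G, (deg u <= b)%N) ->
    (forall u v : G, adj u v ->
      upper_tight b (deg u) (deg v)) ->
    (forall u v : compl G, adj u v ->
      upper_tight b (deg u) (deg v)) ->
  n = 4%N \/ both_regular G.
Proof.
move=> db db' t t'; have n3 := biconnected_order_ge4.
have [b2|b2] := eqVneq b 2%N.
  have [n4|n4] := eqVneq n 4%N; [by left | right].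
  by exists 2%N; split=> u; have := deg_add_compl u; have := db u; have := db' u;
    lia.
right; exists b; split; apply: adj_const_regular => u.
- by have /andP[] := biconnected_deg u.
- by move=> v /t; rewrite /upper_tight (negbTE b2) => /andP[/eqP].
- by have /andP[] := biconnected_deg_compl u.
- by move=> v /t'; rewrite /upper_tight (negbTE b2) => /andP[/eqP].
Qed.

(** The hypotheses on [alpha] and [beta] are the inequalities through which the
    least non-pendent degree and the greatest degree of the two graphs are
    used; they force [alpha = beta = 2] when [n = 4], and [alpha = beta = r]
    when both graphs are [r]-regular. *)
Lemma extremal_edges_tight (alpha beta : nat) :
    (exists2 u : G, ~~ pendent u & (alpha <= deg u <= beta)%N) ->
    (forall k, (forall u : G, ~~ pendent u -> (k <= deg u)%N) ->
      (forall u : compl G, ~~ pendent u -> (k <= deg u)%N) ->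
      (k <= n)%N -> (k <= alpha)%N) ->
    (forall k, (forall u : G, (deg u <= k)%N) ->
      (forall u : compl G, (deg u <= k)%N) -> (beta <= k)%N) ->
    n = 4%N \/ both_regular G ->
  [/\ forall u v : G, adj u v -> lower_tight alpha (n - 2) (deg u) (deg v),
      forall u v : compl G, adj u v ->
        lower_tight alpha (n - 2) (deg u) (deg v),
      forall u v : G, adj u v ->
        upper_tight beta (deg u) (deg v)
    & forall u v : compl G, adj u v ->
        upper_tight beta (deg u) (deg v)].
Proof.
case=> u0 np0 /andP[au0 bu0] a_max b_min; have n3 := biconnected_order_ge4.
case=> [n4|[r [reg reg']]].
  have d (u : G) : (0 < deg u <= 2)%N by have := biconnected_deg u; rewrite n4.
  have d' (u : G) : (0 < @deg (compl G) u <= 2)%N.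
    by have := biconnected_deg_compl u; rewrite n4.
  have d0 : deg u0 = 2%N by have := d u0; move: np0; rewrite /pendent; lia.
  have a2 : alpha = 2%N.
    have : (2 <= alpha)%N.
      apply: a_max => [u|u|]; last by rewrite n4.
        by have := d u; rewrite /pendent; lia.
      by have := d' u; rewrite /pendent; lia.
    lia.
  have b2 : beta = 2%N.
    have : (beta <= 2)%N.
      by apply: b_min => u; [have /andP[] := d u | have /andP[] := d' u].
    lia.
  split=> u v uv; rewrite /upper_tight ?b2 // /lower_tight a2 n4 /=.
    by have := d u; have := d v; have := edge_deg_sum uv;
      case: ifP; lia.
  by have := d' u; have := d' v; have := compl_edge_deg_sum uv;
    case: ifP; lia.
have r_gt1 : (1 < r)%N by have := deg_add_compl u0; rewrite reg reg'; lia.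
have rn : (r <= n)%N by have := deg_add_compl u0; rewrite reg; lia.
have ar : alpha = r.
  apply/eqP; rewrite eqn_leq; move: au0; rewrite reg => -> /=.
  by apply: a_max => // u _; rewrite ?reg ?reg'.
have br : beta = r.
  apply/eqP; rewrite eqn_leq; move: bu0; rewrite reg => ->; rewrite andbT.
  by apply: b_min => u; rewrite ?reg ?reg'.
have r1 : (r == 1%N) = false by rewrite gtn_eqF.
by split=> u v _; rewrite ?reg ?reg' /lower_tight /upper_tight
  ?ar ?br ?r1 ?eqxx ?orbT.
Qed.

Lemma exists_nonpendent : exists u : G, ~~ pendent u.
Proof.
have [u _] := exists_vertex.
have /andP[/deg_gt0P[v uv] _] := biconnected_deg u.
have := edge_deg_sum uv.
have [/eqP-> |npu] := boolP (pendent u); last by exists u.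
by have [/eqP-> //|npv] := boolP (pendent v); exists v.
Qed.

(** * The two bounds *)

Lemma AZI_sum_lower (R : realFieldType) (a : nat) :
    (1 < a)%N -> (a <= n - 2)%N ->
    (forall u : G, ~~ pendent u -> (a <= deg u)%N) ->
    (forall u : compl G, ~~ pendent u -> (a <= deg u)%N) ->
  ((num_pendent G)%:R + (num_pendent (compl G))%:R)
      * ((n%:R - 2) / (n%:R - 3)) ^+ 3 * (1 - ((n%:R - 2) / 2) ^+ 3)
    + 'C(n, 2)%:R * (a%:R ^+ 2 / (2 * a%:R - 2)) ^+ 3
  <= AZI R G + AZI R (compl G)
    ?= iff [forall u : G, forall (v | adj u v),
             lower_tight a (n - 2) (deg u) (deg v)]
        && [forall u : compl G, forall (v | adj u v),
             lower_tight a (n - 2) (deg u) (deg v)].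
Proof.
move=> a1 an da da'; have n3 := biconnected_order_ge4.
rewrite -(mono_leif (ler_pMn2r (isT : (0 < 2)%N))) [X in _ <= X ?= iff _]mulrnDl.
have := leifD (AZI_lower R a1 an biconnected_deg da edge_deg_sum)
  (AZI_lower R a1 an biconnected_deg_compl da' compl_edge_deg_sum).
congr (_ <= _ ?= iff _).
rewrite addrACA -!mulrnDr -mulnDr sum_deg_compl order_eq.
rewrite -edge_weight_diag.
have m_nat : (n - 2)%:R = n%:R - 2 :> R by rewrite natrB // ltnW.
(* [m_nat] and [n3R] serve the identities [w(1, n-2) = ((n-2)/(n-3))^3] and
   [w(n-2, n-2) = w(1, n-2) ((n-2)/2)^3], which give the stated correction. *)
have n3R : n%:R - 3 != 0 :> R.
  by rewrite subr_eq0 eqr_nat gtn_eqF.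
have -> : edge_weight R 1 (n - 2) = ((n%:R - 2) / (n%:R - 3)) ^+ 3.
  rewrite /edge_weight m_nat mul1r; congr ((_ / _) ^+ 3); ring.
have -> : edge_weight R (n - 2) (n - 2) =
    ((n%:R - 2) / (n%:R - 3)) ^+ 3 * ((n%:R - 2) / 2) ^+ 3.
  rewrite /edge_weight m_nat -exprMn; congr (_ ^+ 3).
  have -> : n%:R - 2 + (n%:R - 2) - 2 = 2 * (n%:R - 3) :> R by ring.
  by field.
move: (edge_weight R a a) ((_ / _) ^+ 3) ((_ / _) ^+ 3) => w t s.
rewrite -[w *+ _]mulr_natr -[(_ - _) *+ _]mulr_natr !natrM natrD.
ring.
Qed.

Lemma AZI_sum_upper (R : realFieldType) (b : nat) :
    (forall u : G, (deg u <= b)%N) -> (forall u : compl G, (deg u <= b)%N) ->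
  AZI R G + AZI R (compl G)
    <= 'C(n, 2)%:R * (b%:R ^+ 2 / (2 * b%:R - 2)) ^+ 3
    ?= iff [forall u : G, forall (v | adj u v),
             upper_tight b (deg u) (deg v)]
        && [forall u : compl G, forall (v | adj u v),
             upper_tight b (deg u) (deg v)].
Proof.
move=> db db'.
rewrite -(mono_leif (ler_pMn2r (isT : (0 < 2)%N))) [X in X <= _ ?= iff _]mulrnDl.
have dpos (u : G) : (0 < deg u <= b)%N.
  by rewrite db andbT; have /andP[] := biconnected_deg u.
have dpos' (u : compl G) : (0 < deg u <= b)%N.
  by rewrite db' andbT; have /andP[] := biconnected_deg_compl u.
have := leifD (AZI_upper R dpos edge_deg_sum)
  (AZI_upper R dpos' compl_edge_deg_sum).
congr (_ <= _ ?= iff _).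
by rewrite -mulrnDr sum_deg_compl order_eq mulnC mulrnA -edge_weight_diag mulr_natl.
Qed.

End Biconnected.

(** * Extremal degrees and isomorphisms *)

Lemma min_nonpendent_deg_le (G : sgraph) (u : G) :
  ~~ pendent u -> (min_nonpendent_deg G <= deg u)%N.
Proof.
move=> npu; rewrite /min_nonpendent_deg -minEnat.
by rewrite -leEnat bigmin_le_cond.
Qed.

Lemma min_nonpendent_deg_ge (G : sgraph) (k : nat) :
    (forall u : G, ~~ pendent u -> (k <= deg u)%N) -> (k <= #|G|)%N ->
  (k <= min_nonpendent_deg G)%N.
Proof.
move=> dk nk; apply: (big_ind (fun d => k <= d)%N) => // x y kx ky.
by rewrite leq_min kx.
Qed.

Lemma deg_le_max_deg (G : sgraph) (u : G) : (deg u <= max_deg G)%N.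
Proof. exact: leq_bigmax. Qed.

Lemma max_deg_le (G : sgraph) (k : nat) :
  (forall u : G, (deg u <= k)%N) -> (max_deg G <= k)%N.
Proof. by move=> dk; apply/bigmax_leqP. Qed.

Lemma isomorphic_refl (G : sgraph) : isomorphic G G.
Proof. by exists id => //; exists id. Qed.

Lemma isomorphic_card (G H : sgraph) : isomorphic G H -> #|G| = #|H|.
Proof. by case=> f /bij_eq_card. Qed.

Lemma isomorphic_regular (G H : sgraph) (r : nat) :
  isomorphic G H -> regular r H -> regular r G.
Proof.
case=> f f_bij f_adj regH u; rewrite -(regH (f u)) /deg.
rewrite -(card_imset _ (bij_inj f_bij)); apply: eq_card => w.
have [g gK fK] := f_bij; rewrite -[w]fK mem_imset ?inE ?f_adj //.
exact: bij_inj.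
Qed.

Lemma forall_adjP (G : sgraph) (P : G -> G -> bool) :
  reflect (forall u v, adj u v -> P u v) [forall u, forall (v | adj u v), P u v].
Proof.
apply: (iffP forallP) => [h u v uv|h u]; last by apply/forall_inP => v /h.
exact: (forall_inP (h u)).
Qed.

Theorem theorem4 (R : realFieldType) (n : nat) (G : sgraph) :
  (3 <= n)%N -> #|G| = n -> gconnected G -> gconnected (compl G) ->
  let p := num_pendent G in
  let pbar := num_pendent (compl G) in
  let alpha := minn (min_nonpendent_deg G) (min_nonpendent_deg (compl G)) in
  let beta := maxn (max_deg G) (max_deg (compl G)) in
  let total : R := AZI R G + AZI R (compl G) in
  let lower : R :=
    (p%:R + pbar%:R) * ((n%:R - 2) / (n%:R - 3)) ^+ 3
      * (1 - ((n%:R - 2) / 2) ^+ 3)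
    + 'C(n, 2)%:R * (alpha%:R ^+ 2 / (2 * alpha%:R - 2)) ^+ 3 in
  let upper : R :=
    'C(n, 2)%:R * (beta%:R ^+ 2 / (2 * beta%:R - 2)) ^+ 3 in
  let extremal : Prop :=
    isomorphic G path4 \/
    exists (r : nat) (H : sgraph),
      [/\ regular r H, #|H| = (2 * r + 1)%N & isomorphic G H] in
  [/\ lower <= total,
      total <= upper,
      total = lower <-> extremal
    & total = upper <-> extremal].
Proof.
move=> n_gt2 order_eq conn conn_compl p pbar alpha beta total lower upper extremal.
have [u0 np0] := exists_nonpendent conn conn_compl order_eq n_gt2.
have n_gt3 := biconnected_order_ge4 conn conn_compl order_eq n_gt2.
have dpos := biconnected_deg conn conn_compl order_eq n_gt2.
have dpos' := biconnected_deg_compl conn conn_compl order_eq n_gt2.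
have da (u : G) : ~~ pendent u -> (alpha <= deg u)%N.
  by move/min_nonpendent_deg_le => h; rewrite geq_min h.
have da' (u : compl G) : ~~ pendent u -> (alpha <= deg u)%N.
  by move/min_nonpendent_deg_le => h; rewrite geq_min h orbT.
have a_max k : (forall u : G, ~~ pendent u -> (k <= deg u)%N) ->
    (forall u : compl G, ~~ pendent u -> (k <= deg u)%N) ->
    (k <= n)%N -> (k <= alpha)%N.
  by move=> kG kG' kn; rewrite leq_min !min_nonpendent_deg_ge //= order_eq.
have db (u : G) : (deg u <= beta)%N by rewrite leq_max deg_le_max_deg.
have db' (u : compl G) : (deg u <= beta)%N by rewrite leq_max deg_le_max_deg orbT.
have b_min k : (forall u : G, (deg u <= k)%N) ->
    (forall u : compl G, (deg u <= k)%N) -> (beta <= k)%N.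
  by move=> kG kG'; rewrite geq_max !max_deg_le.
have a1 : (1 < alpha)%N.
  apply: a_max => [u|u|]; last by rewrite ltnW.
    by have := dpos u; rewrite /pendent; lia.
  by have := dpos' u; rewrite /pendent; lia.
have an : (alpha <= n - 2)%N.
  by apply: leq_trans (da u0 np0) _; have /andP[] := dpos u0.
have extremalE : extremal <-> n = 4%N \/ both_regular G.
  split.
    case=> [/isomorphic_card|[r [H [regH cardH isoGH]]]].
      by rewrite order_eq card_ord; left.
    right; exists r; have regG := isomorphic_regular isoGH regH.
    split=> // u; have := @deg_compl G u.
    by rewrite (isomorphic_card isoGH) cardH regG; lia.
  case=> [n4|[r [regG regG']]].
    by left; apply: biconnected_order4_path4 n_gt2 n4.
  right; exists r, G; split; [by [] | | exact: isomorphic_refl].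
  by rewrite -(deg_compl u0) regG regG'; lia.
have tight : n = 4%N \/ both_regular G -> _ :=
  extremal_edges_tight conn conn_compl order_eq n_gt2 _ a_max b_min.
have lo_leif := AZI_sum_lower conn conn_compl order_eq n_gt2 R a1 an da da'.
have up_leif := AZI_sum_upper conn conn_compl order_eq n_gt2 R db db'.
split; [exact: lo_leif.1 | exact: up_leif.1 | |]; rewrite extremalE; split.
- move/esym/eqP; rewrite lo_leif.2 => /andP[/forall_adjP tG /forall_adjP tG'].
  exact: (lower_tight_structure conn conn_compl order_eq n_gt2 a1).
- case/tight => [|tG tG' _ _]; first by exists u0; rewrite // da ?db.
  by apply/esym/eqP; rewrite lo_leif.2; apply/andP; split; apply/forall_adjP.
- move/eqP; rewrite up_leif.2 => /andP[/forall_adjP tG /forall_adjP tG'].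
  exact: (upper_tight_structure conn conn_compl order_eq n_gt2 db).
case/tight => [|_ _ tG tG']; first by exists u0; rewrite // da ?db.
by apply/eqP; rewrite up_leif.2; apply/andP; split; apply/forall_adjP.
Qed.
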